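(* Let $\beta\in(0,1]$ be fixed and let $x^1,\dots,x^T$ be revealed online with each $x^t\in K_t$ (and $x^0=0$). For any $\delta\in(0,1)$ and $\alpha\ge1$ there is a randomized dynamic rounding scheme maintaining matchings $M^t$ in $G^t$ such that \[\mathbb E\left[\sum_{t\in[T]}|M^t\oplus M^{t-1}|\right]\le O\!\left(\frac{\alpha\log n}{\delta^3}\right)\sum_{t\in[T]}\|x^t-x^{t-1}\|_1+O\!\left(\frac{T}{\delta n^\alpha}\right),\] and $\mathbb E[|M^t|]\ge(1-\delta)\sum_{e\in E^t}x_e^t$ for all $t\in[T]$.
   Context: Dynamic bipartite matching: a bipartite graph $G=(V,E)$ with $|V|=n$; at each time $t\in[T]$ one edge is inserted into or deleted from $E$, giving $G^t=(V,E^t)$. $\mathrm{OPT}^t$ is the maximum value of a fractional matching in $G^t$. Vectors are indexed by all potential edges $e\in\binom V2$; $\partial(v)$ is the set of potential edges incident to $v$. $K_t=\{x\in\mathbb{R}_+^{\binom V2}:\sum_{e\in\partial(v)}x_e\le1\ \forall v,\ x_e=0\ \forall e\notin E^t,\ \sum_{e\in E^t}x_e\ge\beta\,\mathrm{OPT}^t\}$. A dynamic rounding scheme chooses $M^t$ (a matching in $G^t$, $M^0=\emptyset$) based only on $x^1,\dots,x^t$ and its randomness; $\oplus$ is symmetric difference. *)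

(* Defs.v *)
From HB Require Import structures.
From mathcomp Require Import all_boot all_order all_algebra.
From mathcomp Require Import all_classical all_reals all_analysis.
Set Implicit Arguments.
Unset Strict Implicit.
Unset Printing Implicit Defensive.
Import Order.TTheory GRing.Theory Num.Theory.
Local Open Scope ring_scope.

(* Graphs are subsets of the finite type of all
   potential edges on V, so that vectors x live in a space that does not
   depend on the current graph. *)
Definition pedge (V : finType) : finType := {e : {set V} | #|e| == 2%N}.

Definition incident (V : finType) (v : V) : {set pedge V} :=
  [set e : pedge V | v \in val e]%SET.

(* No bipartition is fixed in advance: it may differ between the graphs of a
   dynamic sequence. *)
Definition bipartite (V : finType) (E : {set pedge V}) : Prop :=
  exists A : {set V}, forall e : pedge V, e \in E -> #|val e :&: A| = 1%N.

Definition matching_in (V : finType) (E M : {set pedge V}) : Prop :=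
  M \subset E /\
  forall e f : pedge V, e \in M -> f \in M -> e != f ->
    [disjoint val e & val f].

Definition symdiff (T : finType) (A B : {set T}) : {set T} :=
  (A :\: B) :|: (B :\: A).

Definition evec (V : finType) (R : realType) := {ffun pedge V -> R}.

Definition l1norm (V : finType) (R : realType) (x : evec V R) : R :=
  \sum_e `|x e|.

Definition fractional_matching (V : finType) (R : realType)
    (E : {set pedge V}) (x : evec V R) : Prop :=
  [/\ forall e, 0 <= x e,
      forall v, \sum_(e in incident v) x e <= 1 &
      forall e, e \notin E -> x e = 0].

Definition value (V : finType) (R : realType)
    (E : {set pedge V}) (x : evec V R) : R := \sum_(e in E) x e.

(* The set of values is nonempty, bounded and compact, so this supremum is
   the maximum. *)
Definition OPT (V : finType) (R : realType) (E : {set pedge V}) : R :=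
  sup [set value E x | x in [set x : evec V R | fractional_matching E x]]%classic.

Definition in_K (V : finType) (R : realType) (beta : R) (E : {set pedge V})
    (x : evec V R) : Prop :=
  fractional_matching E x /\ beta * OPT R E <= value E x.

Definition edge_update (V : finType) (E E' : {set pedge V}) : Prop :=
  exists e : pedge V,
    (e \notin E /\ E' = e |: E) \/ (e \in E /\ E' = E :\ e).

(* E 0 is the initial graph; it is arbitrary. *)
Definition dynamic_bipartite_graph (V : finType) (T : nat)
    (E : nat -> {set pedge V}) : Prop :=
  (forall t, (t <= T)%N -> bipartite (E t)) /\
  (forall t, (t < T)%N -> edge_update (E t) (E t.+1)).

(* [:: x 1; ...; x t] *)
Definition history (V : finType) (R : realType) (x : nat -> evec V R)
    (t : nat) : seq (evec V R) := [seq x s | s <- iota 1 t].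

(* A randomized online rule: all randomness is the sample point of Omega, and
   the edge set selected at time t is a function of that sample point and of
   [:: x 1; ...; x t] only.  Measurability makes the expectations below
   meaningful; nothing is required of the dependence on the history. *)
Record dynamic_scheme (V : finType) (R : realType) (d : measure_display)
    (Omega : measurableType d) := DynamicScheme {
  select :> seq (evec V R) -> Omega -> {set pedge V};
  select_measurable : forall (h : seq (evec V R)) (M : {set pedge V}),
    measurable [set w | select h w = M]%classic;
  select_nil : forall w, select [::] w = finset.set0 }.

Definition maintained (V : finType) (R : realType) (d : measure_display)
    (Omega : measurableType d) (A : dynamic_scheme V R Omega)
    (x : nat -> evec V R) (t : nat) (w : Omega) : {set pedge V} :=
  A (history x t) w.

Definition recourse (V : finType) (R : realType) (d : measure_display)
    (Omega : measurableType d) (A : dynamic_scheme V R Omega)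
    (x : nat -> evec V R) (T : nat) (w : Omega) : R :=
  \sum_(1 <= t < T.+1)
    #|symdiff (maintained A x t w) (maintained A x t.-1 w)|%:R.

(* Main.v *)
(* Every potential edge e draws one uniform threshold for the whole run and is
   sampled at time t when its threshold is below k x^t_e, where k is of order
   log(1/delta)/delta^2.  Thus the sampled graph changes by at most
   k |x^t - x^(t-1)|_1 edges in expectation.  Reweighting the sampled edges by
   inverse probabilities is unbiased, and a Chernoff bound conditional on e being
   sampled shows that both endpoints of e carry load at most 1 + eps except with
   probability eps, so the sampled graph has a fractional matching of expected
   value at least (1 - O(eps)) |x^t|_1.

   In the sampled graph the matching is repaired by short augmentations only: a
   matching without augmenting walk of l steps is within a factor 1 + 1/(l+1) of
   every fractional matching, and each augmentation changes 2l+1 edges and gains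
   one, which amortizes to 2l+2 changes per change of the sampled graph.  Taking
   l of order min(n, 1/delta), the product k l is O(log n / delta^3).

   Thresholds take finitely many values, so the sample space is finite.  A grid
   of N values costs an extra 1/N per edge and step, which the additive term
   T / (delta n^alpha) absorbs once N is large. *)
From HB Require Import structures.
Require Import Defs.
From mathcomp Require Import all_boot all_order all_algebra.
From mathcomp Require Import all_classical all_reals all_analysis.
From mathcomp Require Import fintype finset zify ring lra.
Set Implicit Arguments.
Unset Strict Implicit.
Unset Printing Implicit Defensive.
Import Order.TTheory GRing.Theory Num.Theory.
Local Open Scope ring_scope.

(** * Alternating walks and short augmentations *)

Section AlternatingWalks.
Local Open Scope nat_scope.
Local Open Scope set_scope.
Variables (U V : finType) (l r : U -> V) (H : {set U}).
Implicit Types (M N : {set U}) (a b : V).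

Definition lr_matching M : bool :=
  [&& M \subset H,
      [forall e in M, forall f in M, (l e == l f) ==> (e == f)]
    & [forall e in M, forall f in M, (r e == r f) ==> (e == f)]].

Lemma lr_matchingP M :
  reflect [/\ {subset M <= H}, {in M &, injective l} & {in M &, injective r}]
          (lr_matching M).
Proof.
apply: (iffP and3P) => [[/subsetP sMH injl injr]|[sMH injl injr]]; split=> //.
- move=> e f eM fM lef; apply/eqP.
  by move/forall_inP: injl => /(_ _ eM)/forall_inP/(_ _ fM)/implyP; apply; apply/eqP.
- move=> e f eM fM ref; apply/eqP.
  by move/forall_inP: injr => /(_ _ eM)/forall_inP/(_ _ fM)/implyP; apply; apply/eqP.
- exact/subsetP.
- by apply/forall_inP => e eM; apply/forall_inP => f fM; apply/implyP => /eqP/injl ->.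
- by apply/forall_inP => e eM; apply/forall_inP => f fM; apply/implyP => /eqP/injr ->.
Qed.

Lemma card_symdiff_triangle (A B C : {set U}) :
  #|symdiff A C| <= #|symdiff A B| + #|symdiff B C|.
Proof.
apply: leq_trans (leq_card_setU _ _); apply: subset_leq_card.
apply/subsetP => z; rewrite !inE.
by case: (z \in A); case: (z \in B); case: (z \in C).
Qed.

Lemma symdiffC (A B : {set U}) : symdiff A B = symdiff B A.
Proof. by rewrite /symdiff setUC. Qed.

(* [alt_walk M j a b]: an [M]-alternating walk of length [2j+1] from the left
   vertex [a] to the right vertex [b]; it may revisit vertices. *)
Fixpoint alt_walk M (j : nat) (a b : V) : Prop :=
  match j with
  | 0 => exists2 e, e \in H & l e = a /\ r e = b
  | i.+1 => exists e m, [/\ e \in H, m \in M, l e = a, r m = r e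
                          & alt_walk M i (l m) b]
  end.

(** [alt_walk] unfolds from its left end, while the layers below extend walks at the right end. *)
Lemma alt_walk_snoc M j a m e : m \in M -> e \in H -> l e = l m ->
  alt_walk M j a (r m) -> alt_walk M j.+1 a (r e).
Proof.
move=> mM eH lem; elim: j a => [|j IH] a /=.
  by move=> [f fH [lf rf]]; exists f, m; split=> //; exists e.
by move=> [f [m' [fH m'M lf rm' /IH W]]]; exists f, m'.
Qed.

(** The dichotomy is whether the walk uses [m]; if so, the tail after its first use is kept. This
    replaces a reduction to simple paths. *)
Lemma alt_walk_swap M e m j a b :
  alt_walk M j a b -> alt_walk (e |: (M :\ m)) j a b \/
    exists2 i, i < j & alt_walk M i (l m) b.
Proof.
elim: j a => [|j IH] a /=; first by left.
move=> [f [m' [fH m'M lf rm' W]]]; have [m'm|nm'm] := eqVneq m' m.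
  by right; exists j => //; rewrite -m'm.
have [W'|[i ij W']] := IH _ W; last by right; exists i => //; exact: ltnW.
by left; exists f, m'; split=> //; rewrite !inE nm'm m'M orbT.
Qed.

(** Exchanging the first two edges keeps the size, costs two changes and moves the free left vertex
    from [a] to [l m], leaving a walk one step shorter. *)
Lemma augment M j a b : lr_matching M ->
  {in M, forall m, l m != a} -> {in M, forall m, r m != b} -> alt_walk M j a b ->
  exists M', [/\ lr_matching M', #|M'| = #|M|.+1 & #|symdiff M M'| <= j.*2.+1].
Proof.
have [k] := ubnP j; elim: k => // k IHk in M j a b *; rewrite ltnS => jk.
move=> /lr_matchingP[sMH injl injr] freea freeb.
have notinM e : l e = a -> e \notin M.
  by move=> le; apply/negP => /freea; rewrite le eqxx.
case: j jk => [|j] jk /=.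
  move=> [e eH [le re]]; exists (e |: M); split; last 2 first.
  - by rewrite cardsU1 notinM.
  - rewrite -(cards1 e); apply: subset_leq_card; apply/subsetP => z.
    by rewrite !inE; case: (z \in M); rewrite ?orbT ?orbF ?andbF.
  apply/lr_matchingP; split.
  - by move=> z /setU1P[->|/sMH].
  - move=> z y /setU1P[->|zM] /setU1P[->|yM] //; last exact: injl.
      by rewrite le => Ea; have := freea _ yM; rewrite Ea eqxx.
    by rewrite le => Ea; have := freea _ zM; rewrite Ea eqxx.
  - move=> z y /setU1P[->|zM] /setU1P[->|yM] //; last exact: injr.
      by rewrite re => Ea; have := freeb _ yM; rewrite Ea eqxx.
    by rewrite re => Ea; have := freeb _ zM; rewrite Ea eqxx.
move=> [e [m [eH mM le rm W]]].
(* If the walk returns to [m], the loop is cut out: [e], [m] and the later tail form a shorter walk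
   for the same [M]. Hence the strong induction. *)
have [{}W|[i ij W']] := alt_walk_swap e m W; last first.
  have ij1 : i.+1 < k by apply: leq_trans jk; rewrite !ltnS.
  have [M' [mM' cM' dM']] : exists M', [/\ lr_matching M', #|M'| = #|M|.+1
      & #|symdiff M M'| <= i.+1.*2.+1].
    apply: (IHk M i.+1 a b) => //; first exact/lr_matchingP.
    by exists e, m.
  exists M'; split=> //; apply: leq_trans dM' _.
  by rewrite ltnS leq_double ltnS ltnW.
pose M1 := e |: (M :\ m).
have eM : e \notin M by exact: notinM.
have em : e != m by apply: contraNneq eM => ->.
have cM1 : #|M1| = #|M|.
  by rewrite /M1 cardsU1 !inE negb_and eM orbT (cardsD1 m M) mM.
have mM1 : lr_matching M1.
  apply/lr_matchingP; split.
  - by move=> z /setU1P[->|/setD1P[_ /sMH]].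
  - move=> z y /setU1P[->|/setD1P[zm zM]] /setU1P[->|/setD1P[ym yM]] //;
      last exact: injl.
      by rewrite le => Ea; have := freea _ yM; rewrite Ea eqxx.
    by rewrite le => Ea; have := freea _ zM; rewrite Ea eqxx.
  - move=> z y /setU1P[->|/setD1P[zm zM]] /setU1P[->|/setD1P[ym yM]] //;
      last exact: injr.
      by rewrite -rm => /(injr _ _ mM yM) mE; rewrite mE eqxx in ym.
    by rewrite -rm => /(injr _ _ zM mM) mE; rewrite mE eqxx in zm.
have dM1 : #|symdiff M M1| <= 2.
  have -> : 2 = #|[set e; m]| by rewrite cards2 em.
  apply: subset_leq_card; apply/subsetP => z.
  by rewrite !inE; case: (z \in M); case: (z == m); rewrite ?orbT ?orbF ?andbF ?andbT ?negbK.
have [M' [mM' cM' dM']] : exists M', [/\ lr_matching M', #|M'| = #|M1|.+1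
      & #|symdiff M1 M'| <= j.*2.+1].
  apply: (IHk M1 j (l m) b) => //.
  - move=> z /setU1P[->|/setD1P[zm zM]].
      by rewrite le eq_sym; exact: freea.
    by apply: contraNneq zm => /(injl _ _ zM mM) ->.
  - move=> z /setU1P[->|/setD1P[zm zM]]; last exact: freeb.
    by rewrite -rm freeb.
exists M'; split=> //; first by rewrite cM' cM1.
apply: leq_trans (card_symdiff_triangle M M1 M') _.
by rewrite doubleS -addn2 addnC; apply: leq_trans (leq_add dM' dM1) _; rewrite addn2.
Qed.

(** Breadth-first search: the edges of [M] that an alternating walk from an unmatched left vertex
    reaches by using at most [j] of them. *)
Fixpoint layer M (j : nat) : {set U} :=
  match j with
  | 0 => set0
  | i.+1 => [set m in M | [exists e in H, (r e == r m) &&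
      ([exists m' in layer M i, l m' == l e] || [forall m' in M, l m' != l e])]]
  end.

Lemma layer_sub M j : layer M j \subset M.
Proof.
by case: j => [|j] /=; rewrite ?sub0set//; apply/subsetP => z; rewrite inE => /andP[].
Qed.

Lemma layer_walk M j e : e \in H ->
  [exists m' in layer M j, l m' == l e] || [forall m' in M, l m' != l e] ->
  exists i a, [/\ i <= j, {in M, forall m, l m != a} & alt_walk M i a (r e)].
Proof.
elim: j e => [|j IH] e eH.
  case/orP => [/exists_inP[m]|/forall_inP free]; first by rewrite inE.
  by exists 0, (l e); split=> //; exists e.
case/orP => [/exists_inP[m]|/forall_inP free]; last first.
  by exists 0, (l e); split=> //; exists e.
move=> mL /eqP lme; move: mL; rewrite /= inE => /andP[mM].
case/exists_inP => f fH /andP[/eqP rfm /(IH f fH)[i [a [ij free W]]]].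
exists i.+1, a; split=> //; apply: (@alt_walk_snoc M i a m) => //.
by rewrite -rfm.
Qed.

(* The covers are those of the Hopcroft-Karp analysis: the left vertices outside
   the first [j] layers together with the right vertices of layer [j.+1].  Their
   sizes telescope, so one of them exceeds [#|M|] by at most [#|M| %/ k.+1]. *)
Lemma no_short_walk_value (R : realType) M k (y : U -> R) :
  lr_matching M ->
  (forall i a b, i <= k -> {in M, forall m, l m != a} ->
     {in M, forall m, r m != b} -> ~ alt_walk M i a b) ->
  (forall e, (0 <= y e)%R) ->
  (forall a, (\sum_(e in H | l e == a) y e <= 1)%R) ->
  (forall b, (\sum_(e in H | r e == b) y e <= 1)%R) ->
  (\sum_(e in H) y e <= (#|M| + #|M| %/ k.+1)%:R)%R.
Proof.
move=> /lr_matchingP[sMH injl injr] noaug y0 yl yr.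
pose q := #|M| %/ k.+1.
(* Pigeonhole: growth by at least [q.+1] in each of [k.+1] rounds would exceed [#|M|]. *)
have [j jk jq] : exists2 j, j <= k & #|layer M j.+1| <= #|layer M j| + q.
  apply: contrapT => far.
  have grow j : j <= k.+1 -> j * q.+1 <= #|layer M j|.
    elim: j => // j IH jk.
    have : #|layer M j| + q.+1 <= #|layer M j.+1|.
      by rewrite addnS ltnNge; apply/negP => le; apply: far; exists j.
    apply: leq_trans.
    by rewrite mulSn addnC leq_add2r IH // ltnW.
  have := leq_trans (grow _ (leqnn _)) (subset_leq_card (layer_sub M k.+1)).
  by rewrite leqNgt mulnC -ltn_divLR // ltnS leqnn.
(* If the left end of [e] is reached, the absence of a short augmenting walk forces the right end to
   be matched by an edge of the next layer. Otherwise the left end is matched outside layer [j]. *)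
have cover e : e \in H ->
    [exists m in M :\: layer M j, l e == l m] || [exists m in layer M j.+1, r e == r m].
  move=> eH.
  have [reach|] := boolP ([exists m' in layer M j, l m' == l e] ||
                          [forall m' in M, l m' != l e]).
    apply/orP; right; have [i [a [ij free W]]] := layer_walk eH reach.
    have [/exists_inP[m mM /eqP rm]|nfree] := boolP [exists m in M, r m == r e].
      apply/exists_inP; exists m; last by rewrite rm.
      by rewrite /= inE mM; apply/exists_inP; exists e; rewrite // rm eqxx.
    case: (noaug i a (r e) (leq_trans ij jk) free) => // m mM.
    by move: nfree; rewrite negb_exists_in => /forall_inP/(_ m mM).
  rewrite negb_or negb_forall_in => /andP[nL /exists_inP[m mM /negPn/eqP lm]].
  apply/orP; left; apply/exists_inP; exists m; last by rewrite lm.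
  rewrite inE mM andbT; apply: contra nL => mL.
  by apply/exists_inP; exists m; rewrite ?lm.
(* Weak duality: each [y e] is charged to a cover vertex, whose load is at most one. *)
have : (\sum_(e in H) y e <= \sum_(m in M :\: layer M j) \sum_(e in H | l e == l m) y e
         + \sum_(m in layer M j.+1) \sum_(e in H | r e == r m) y e)%R.
  rewrite (exchange_big_dep (mem H)) /=; last by move=> m e _ /andP[].
  rewrite [X in (_ + X)%R](exchange_big_dep (mem H)) /=; last by move=> m e _ /andP[].
  rewrite -big_split /=; apply: ler_sum => e eH.
  have /orP[/exists_inP[m mM le]|/exists_inP[m mM re]] := cover e eH.
    rewrite (bigD1 m) /=; last by rewrite mM eH le.
    by rewrite -addrA lerDl addr_ge0 // sumr_ge0.
  rewrite addrC (bigD1 m) /=; last by rewrite mM eH re.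
  by rewrite -addrA lerDl addr_ge0 // sumr_ge0.
move=> /le_trans; apply.
apply: (@le_trans _ _ (#|M :\: layer M j| + #|layer M j.+1|)%:R%R); last first.
  rewrite ler_nat cardsD (setIidPr (layer_sub M j)) -/q.
  apply: leq_trans (leq_add (leqnn _) jq) _.
  by rewrite addnA subnK // subset_leq_card // layer_sub.
by rewrite natrD; apply: lerD; rewrite -sumr_const; apply: ler_sum.
Qed.

End AlternatingWalks.

(** * Repair of matchings in a changing bipartite graph *)

Section Repair.
Local Open Scope nat_scope.
Local Open Scope set_scope.
Variable V : finType.
Implicit Types (H M N : {set pedge V}).

Definition matchingb H M : bool :=
  (M \subset H) &&
  [forall e in M, forall f in M, (e != f) ==> [disjoint val e & val f]].

Lemma matchingbP H M : reflect (matching_in H M) (matchingb H M).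
Proof.
apply: (iffP andP) => -[sMH dis]; split=> //.
  by move=> e f eM fM; move/forall_inP: dis => /(_ _ eM)/forall_inP/(_ _ fM)/implyP.
by apply/forall_inP => e eM; apply/forall_inP => f fM; apply/implyP; exact: dis.
Qed.

Lemma matchingb0 H : matchingb H set0.
Proof. by apply/matchingbP; split=> [|e f]; rewrite ?sub0set ?inE. Qed.

Lemma matchingbI H H' M : matchingb H M -> matchingb H' (M :&: H').
Proof.
move=> /matchingbP[_ dis]; apply/matchingbP; split; first exact: subsetIr.
by move=> e f /setIP[eM _] /setIP[fM _]; exact: dis.
Qed.

(** Every gained edge pays for the at most [2k+1] changes of one augmentation. This budget is
    additive, so a largest improvement admits no augmenting walk of at most [k] steps. *)
Definition improvement k H M N : bool :=
  [&& matchingb H N, #|symdiff M N| <= k.*2.+1 * (#|N| - #|M|) & #|M| <= #|N|].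

Definition repair k H M : {set pedge V} :=
  [arg max_(N > M | improvement k H M N) #|N|].

Lemma symdiffv (T : finType) (A : {set T}) : symdiff A A = set0.
Proof. by rewrite /symdiff setDv setU0. Qed.

Lemma repairP k H M : matchingb H M ->
  improvement k H M (repair k H M) /\
  forall N, improvement k H M N -> #|N| <= #|repair k H M|.
Proof.
move=> mM; have MM : improvement k H M M.
  by rewrite /improvement mM symdiffv cards0 leqnn.
by rewrite /repair; case: arg_maxnP.
Qed.

(** Taken for [A] and for its complement, this yields the two end maps; [None] is the default for an
    edge without end in [A]. *)
Definition left_end (A : {set V}) (e : pedge V) : option V :=
  [pick v in val e :&: A].

Lemma left_endE A e : #|val e :&: A| = 1 ->
  exists2 v, left_end A e = Some v & val e :&: A = [set v].
Proof.
move=> /eqP/cards1P[v Av]; exists v => //; rewrite /left_end.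
by case: pickP => [w|/(_ v)]; rewrite Av inE ?eqxx // => /eqP ->.
Qed.

Lemma left_end_Some A e v : left_end A e = Some v -> v \in val e.
Proof. by rewrite /left_end; case: pickP => // w /setIP[we _] [<-]. Qed.

Section Bipartite.
Variables (H : {set pedge V}) (A : {set V}).
Hypothesis HA : forall e, e \in H -> #|val e :&: A| = 1.

Lemma card_val_setC e : e \in H -> #|val e :&: ~: A| = 1.
Proof.
move=> eH; have := cardsID A (val e); rewrite setDE (HA eH) (eqP (valP e)).
by move=> /eqP; rewrite eqSS => /eqP.
Qed.

Lemma disjoint_ends e f : e \in H -> f \in H ->
  [disjoint val e & val f] =
  (left_end A e != left_end A f) && (left_end (~: A) e != left_end (~: A) f).
Proof.
move=> eH fH.
have [a -> ea] := left_endE (HA eH).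
have [b -> fb] := left_endE (HA fH).
have [c -> ec] := left_endE (card_val_setC eH).
have [d -> fd] := left_endE (card_val_setC fH).
have mem (g : {set V}) x y v : g :&: A = [set x] -> g :&: ~: A = [set y] ->
    (v \in g) = if v \in A then v == x else v == y.
  move=> gx gy; move/setP/(_ v): gx; move/setP/(_ v): gy; rewrite !inE.
  by case: (v \in A); rewrite ?andbT ?andbF.
have inA (g B : {set V}) x : g :&: B = [set x] -> x \in B.
  by move=> gx; have /setIP[] : x \in g :&: B by rewrite gx inE.
apply/idP/andP => [dis|[ab cd]].
  split; apply/eqP => -[E].
    have : b \in val e by rewrite (mem _ _ _ _ ea ec) // (inA _ _ _ fb) // E.
    by rewrite (disjointFl dis) // (mem _ _ _ _ fb fd) // (inA _ _ _ fb).
  have dA : d \in A = false by apply/negbTE; have := inA _ _ d fd; rewrite inE.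
  have : d \in val e by rewrite (mem _ _ _ _ ea ec) // dA E.
  by rewrite (disjointFl dis) // (mem _ _ _ _ fb fd) // dA.
apply/pred0P => v /=; rewrite (mem _ _ _ _ ea ec) // (mem _ _ _ _ fb fd) //.
case: ifP => _; apply/negP => /andP[/eqP-> /eqP E].
  by rewrite E eqxx in ab.
by rewrite E eqxx in cd.
Qed.

Lemma matchingbE M :
  matchingb H M = lr_matching (left_end A) (left_end (~: A)) H M.
Proof.
apply/matchingbP/lr_matchingP => [[/subsetP sMH dis]|[sMH injl injr]].
  split=> // e f eM fM lef; apply/eqP; apply: contraTT isT => nef;
    by have := dis e f eM fM nef; rewrite disjoint_ends ?sMH // lef eqxx ?andbF.
split; first exact/subsetP.
move=> e f eM fM nef; rewrite disjoint_ends ?sMH //; apply/andP; split.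
  by apply: contraNneq nef => /injl ->.
by apply: contraNneq nef => /injr ->.
Qed.

Lemma left_end_sum (R : realType) (y : pedge V -> R) (B : {set V})
  (v : option V) :
  (forall e, e \in H -> #|val e :&: B| = 1) ->
  (forall e, (0 <= y e)%R) -> (forall v, \sum_(e in incident v) y e <= 1)%R ->
  (\sum_(e in H | left_end B e == v) y e <= 1)%R.
Proof.
move=> HB y0 y1; case: v => [v|]; last first.
  rewrite big_pred0 // => e; apply/negP => /andP[eH].
  by have [w -> _] := left_endE (HB e eH).
apply: le_trans (y1 v); rewrite [leRHS](bigID (fun e => (e \in H) && (left_end B e == Some v))) /=.
rewrite -[leLHS]addr0 lerD ?sumr_ge0 // le_eqVlt; apply/orP; left; apply/eqP.
apply: eq_bigl => e; apply/esym/andb_idl => /andP[_ /eqP/left_end_Some].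
by rewrite inE.
Qed.

End Bipartite.

Lemma repair_value (R : realType) k H M (y : evec V R) :
  bipartite H -> matchingb H M -> fractional_matching H y ->
  (value H y <= (#|repair k H M| + #|repair k H M| %/ k.+1)%:R)%R.
Proof.
move=> [A HA] mM [y0 y1 _]; have [] := repairP k mM.
move: (repair k H M) => N /and3P[mN dN cN] maxN.
apply: (@no_short_walk_value _ _ (left_end A) (left_end (~: A))) => //.
- by rewrite -matchingbE.
- move=> i a b ik freea freeb W.
  have mN' : lr_matching (left_end A) (left_end (~: A)) H N by rewrite -matchingbE.
  have [N' []] := augment mN' freea freeb W.
  rewrite -matchingbE // => mN2 cN' dN'.
  (* A further augmentation stays within the budget and would beat the maximum. *)
  suff /maxN : improvement k H M N' by rewrite cN' ltnn.
  rewrite /improvement mN2 /= cN' leqW // andbT.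
  apply: leq_trans (card_symdiff_triangle _ N _) _.
  rewrite subSn // mulnS addnC; apply: leq_add => //.
  by apply: leq_trans dN' _; rewrite ltnS leq_double.
- by move=> a; apply: left_end_sum => //.
- by move=> a; apply: left_end_sum => // e; exact: (card_val_setC HA).
Qed.

Lemma repair_recourse k H M : matchingb H M ->
  #|symdiff M (repair k H M)| + k.*2.+1 * #|M| <= k.*2.+1 * #|repair k H M|.
Proof.
move=> /(repairP k)[/and3P[_ d c] _]; move: d.
by rewrite mulnBr leq_subRL ?leq_mul2l ?c ?orbT // addnC.
Qed.

Lemma repair_matching k H M : matchingb H M -> matchingb H (repair k H M).
Proof. by move=> /(repairP k)[/and3P[]]. Qed.

Lemma total_recourse k (H M : nat -> {set pedge V}) T :
  H 0 = set0 -> M 0 = set0 ->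
  (forall t, M t.+1 = repair k (H t.+1) (M t :&: H t.+1)) ->
  \sum_(1 <= t < T.+1) #|symdiff (M t) (M t.-1)| <=
    k.+1.*2 * \sum_(1 <= t < T.+1) #|symdiff (H t) (H t.-1)|.
Proof.
move=> H0 M0 MS.
have mM t : matchingb (H t) (M t).
  elim: t => [|t IH]; first by rewrite M0 matchingb0.
  by rewrite MS; apply/repair_matching/(@matchingbI (H t)).
have sub t : M t \subset H t by case/matchingbP: (mM t).
(* The potential is [(2k+1) (#|H| - #|M|)]: an inserted edge raises it by [2k+1], an augmentation is
   paid out of it, and the deletion of a matched edge leaves it unchanged at the cost of one
   change. *)
suff: \sum_(1 <= t < T.+1) #|symdiff (M t) (M t.-1)| + k.*2.+1 * #|H T| <=
    k.+1.*2 * \sum_(1 <= t < T.+1) #|symdiff (H t) (H t.-1)| + k.*2.+1 * #|M T|.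
  have: k.*2.+1 * #|M T| <= k.*2.+1 * #|H T| by rewrite leq_mul2l subset_leq_card ?orbT.
  by lia.
elim: T => [|T IH]; first by rewrite !big_geq // H0 cards0 muln0.
rewrite big_nat_recr //= [in leqRHS]big_nat_recr //=.
have cS (A B : {set pedge V}) : #|symdiff A B| = #|A :\: B| + #|B :\: A|.
  rewrite /symdiff cardsU (_ : _ :&: _ = set0) ?cards0 ?subn0 //.
  by apply/setP => z; rewrite !inE; case: (z \in A); case: (z \in B).
have hS := cS (H T.+1) (H T).
have cHS := cardsID (H T) (H T.+1).
have cH := cardsID (H T.+1) (H T).
have cM := cardsID (H T.+1) (M T).
have lost : #|M T :\: H T.+1| <= #|H T :\: H T.+1| by rewrite subset_leq_card // setSD.
have := @repair_recourse k (H T.+1) _ (matchingbI (H T.+1) (mM T)).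
rewrite -MS => rec.
have tri := card_symdiff_triangle (M T.+1) (M T :&: H T.+1) (M T).
have lostE : #|symdiff (M T :&: H T.+1) (M T)| = #|M T :\: H T.+1|.
  rewrite cS (_ : _ :\: M T = set0) ?cards0 ?add0n; last first.
    by apply/setP => z; rewrite !inE; case: (z \in M T).
  by apply: eq_card => z; rewrite !inE; case: (z \in M T); case: (z \in H T.+1).
rewrite lostE in tri; rewrite symdiffC in rec.
have clost : k.*2.+1 * #|M T :\: H T.+1| <= k.*2.+1 * #|H T :\: H T.+1|.
  by rewrite leq_mul2l lost orbT.
rewrite setIC in cH; move: IH; rewrite hS doubleS -cM -cH -cHS !mulnDr.
move: (k.*2.+1) clost rec => c clost rec; rewrite !mulSn.
have arith (S s s1 x i lo del new D m : nat) : lo <= del -> c * lo <= c * del ->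
    s <= s1 + lo -> s1 + c * i <= c * m ->
    S + (c * x + c * del) <= D + c * D + (c * i + c * lo) ->
    S + s + (c * x + c * new) <= D + c * D + (new + c * new + (del + c * del)) + c * m.
  by clear; lia.
exact: arith lost clost tri rec.
Qed.

End Repair.

(** * Integer rounding and an exponential bound *)

Lemma nat_ceil (R : realType) (a : R) : 0 <= a ->
  exists2 m : nat, forall i : nat, (i%:R < a) = (i < m)%N & a <= m%:R <= a + 1.
Proof.
move=> a0; have /andP[ta at1] := truncn_itv a0.
have [at_|ta'] := leP a (Num.trunc a)%:R.
  have aE : a = (Num.trunc a)%:R by apply/eqP; rewrite eq_le at_ ta.
  exists (Num.trunc a) => [i|]; first by rewrite {1}aE ltr_nat.
  by rewrite at_ -aE lerDl ler01.
exists (Num.trunc a).+1 => [i|]; last by rewrite ltW //= -natr1 lerD2r.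
rewrite ltnS; apply/idP/idP => [ia|it].
  by have := lt_trans ia at1; rewrite ltr_nat ltnS.
by apply: le_lt_trans ta'; rewrite ler_nat.
Qed.

Lemma sum_ord_ltn (n m : nat) : (\sum_(i < n) (i < m : nat) = minn m n)%N.
Proof.
elim: n => [|n IH]; first by rewrite big_ord0 minn0.
by rewrite big_ord_recr /= IH; case: ltnP => h; lia.
Qed.

(** Invert [1 - u <= expR (- u)]; for [u <= 1/2] the reciprocal of [1 - u] is below the
    quadratic. *)
Lemma expR_le1D2 (R : realType) (u : R) : 0 <= u <= 2^-1 ->
  expR u <= 1 + u + 2 * u ^+ 2.
Proof.
move=> /andP[u0 u1]; have e1 : 1 - u <= expR (- u) by exact: expR_ge1Dx.
have u2 : u <= 1 / 2 by rewrite mul1r.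
have p1 : 0 < 1 - u by lra.
have -> : expR u = (expR (- u))^-1 by rewrite expRN invrK.
apply: (@le_trans _ _ (1 - u)^-1).
  by rewrite lef_pV2 ?posrE ?expR_gt0.
rewrite -[leLHS]mul1r ler_pdivrMr //.
have : 0 <= u ^+ 2 * (1 - 2 * u) by apply: mulr_ge0; [exact: sqr_ge0|lra].
by rewrite (_ : (1 + u + 2 * u ^+ 2) * (1 - u) = 1 + u ^+ 2 * (1 - 2 * u)); [lra|ring].
Qed.

(** * Independent thresholds on a finite grid and a Chernoff bound *)

Section UniformThresholds.
Variables (R : realType) (U : finType) (N : nat).
Local Notation W := {ffun U -> 'I_N.+1}.

Definition avg (h : 'I_N.+1 -> R) : R := (\sum_i h i) / N.+1%:R.
Definition mean (F : W -> R) : R := (\sum_w F w) / #|W|%:R.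

Lemma cardW : #|W|%:R = \prod_(u : U) (N.+1%:R : R).
Proof. by rewrite card_ffun card_ord natrX prodr_const. Qed.

Lemma cardW_gt0 : 0 < #|W|%:R :> R.
Proof. by rewrite cardW prodr_gt0. Qed.

(** Independence of the thresholds, by distributing a product over sums. *)
Lemma mean_prod (g : U -> 'I_N.+1 -> R) :
  mean (fun w => \prod_u g u (w u)) = \prod_u avg (g u).
Proof. by rewrite /mean -bigA_distr_bigA cardW -prodf_div. Qed.

Lemma avg_cst (c : R) : avg (fun=> c) = c.
Proof.
by rewrite /avg sumr_const card_ord -[c *+ _]mulr_natr mulfK // pnatr_eq0.
Qed.

Lemma mean_coord (h : 'I_N.+1 -> R) u : mean (fun w => h (w u)) = avg h.
Proof.
pose g v := if v == u then h else fun=> 1.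
have -> : (fun w : W => h (w u)) = fun w => \prod_v g v (w v).
  apply/funext => w; rewrite (bigD1 u) //= big1 ?mulr1 /g ?eqxx //.
  by move=> v /negbTE ->.
rewrite mean_prod (bigD1 u) //= big1 ?mulr1 /g ?eqxx //.
by move=> v /negbTE ->; rewrite avg_cst.
Qed.

Lemma avg_le (h h' : 'I_N.+1 -> R) : (forall i, h i <= h' i) -> avg h <= avg h'.
Proof. by move=> hh; rewrite ler_pM2r ?invr_gt0 ?ltr0n //; apply: ler_sum. Qed.

Lemma avg_ge0 (h : 'I_N.+1 -> R) : (forall i, 0 <= h i) -> 0 <= avg h.
Proof. by move=> h0; rewrite divr_ge0 // sumr_ge0. Qed.

Lemma mean_le (F G : W -> R) : (forall w, F w <= G w) -> mean F <= mean G.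
Proof. by move=> FG; rewrite ler_pM2r ?invr_gt0 ?cardW_gt0 //; apply: ler_sum. Qed.

Lemma meanB (F G : W -> R) : mean (fun w => F w - G w) = mean F - mean G.
Proof. by rewrite /mean -mulrBl sumrB. Qed.

Lemma meanZ (c : R) (F : W -> R) : mean (fun w => c * F w) = c * mean F.
Proof. by rewrite /mean -mulr_sumr mulrA. Qed.

Lemma mean_sum (I : Type) (s : seq I) (P : pred I) (F : I -> W -> R) :
  mean (fun w => \sum_(i <- s | P i) F i w) = \sum_(i <- s | P i) mean (F i).
Proof. by rewrite /mean exchange_big /= mulr_suml. Qed.

Variable k : R.
Hypothesis k_gt0 : 0 < k.

(** The threshold [i / N.+1] is compared with [k * a], denominators cleared; strictness keeps
    [a = 0] from ever being sampled. *)
Definition chosen (a : R) (i : 'I_N.+1) : bool := i%:R < N.+1%:R * (k * a).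

Definition density (a : R) : R := avg (fun i => (chosen a i)%:R).

Let NR_gt0 : 0 < N.+1%:R :> R. Proof. by rewrite ltr0n. Qed.

Lemma chosen0 i : chosen 0 i = false.
Proof. by rewrite /chosen !mulr0 ltNge ler0n. Qed.

Lemma chosenE a : 0 <= a -> exists2 m : nat,
  forall i, chosen a i = (i < m)%N & N.+1%:R * (k * a) <= m%:R <= N.+1%:R * (k * a) + 1.
Proof.
move=> a0; have [|m mE m1] := @nat_ceil R (N.+1%:R * (k * a)).
  by rewrite mulr_ge0 // mulr_ge0 // ltW.
by exists m => // i; rewrite /chosen mE.
Qed.

Lemma avg_ltn (m : nat) :
  avg (fun i => (i < m)%N%:R) = (minn m N.+1)%:R / N.+1%:R.
Proof. by rewrite /avg -sum_ord_ltn natr_sum. Qed.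

Lemma densityE a m : (forall i, chosen a i = (i < m)%N) ->
  density a = (minn m N.+1)%:R / N.+1%:R.
Proof. by move=> mE; rewrite -avg_ltn; congr avg; apply/funext => i; rewrite mE. Qed.

(** The grid rounds [k * a] upwards, so it never lowers the sampling probability. *)
Lemma density_ge a : 0 <= a -> Num.min 1 (k * a) <= density a.
Proof.
move=> a0; have [m mE /andP[m1 _]] := chosenE a0.
rewrite (densityE mE) ler_pdivlMr // natr_min.
rewrite minr_pMl ?ler0n // mul1r minC [X in Num.min X _]mulrC.
by rewrite le_min !ge_min m1 lexx orbT.
Qed.

Lemma density_gt0 a : 0 < a -> 0 < density a.
Proof.
move=> a0; apply: lt_le_trans (density_ge (ltW a0)).
by rewrite lt_min ltr01 mulr_gt0.
Qed.

Lemma density_le1 a : density a <= 1.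
Proof. by rewrite -[leRHS]avg_cst; apply: avg_le => i; case: chosen. Qed.

(** Both values face the same threshold, so the two events are nested and the probability of a
    change is a difference of densities. The last term is the grid rounding. *)
Lemma mean_chosen_change a b u : 0 <= a -> 0 <= b ->
  mean (fun w => (chosen a (w u) != chosen b (w u))%:R) <=
  k * `|a - b| + N.+1%:R^-1.
Proof.
have le_chosen a' b' : a' <= b' -> forall i, chosen a' i -> chosen b' i.
  by move=> ab i /lt_le_trans; apply; rewrite !ler_pM2l.
wlog ab : a b / a <= b => [hw a0 b0|a0 b0].
  have [ab|/ltW ba] := leP a b; first exact: hw.
  rewrite distrC; apply: le_trans (hw _ _ ba b0 a0).
  by apply: mean_le => w; rewrite eq_sym.
rewrite (mean_coord (fun i => (chosen a i != chosen b i)%:R)).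
have -> : avg (fun i => (chosen a i != chosen b i)%:R) = density b - density a.
  rewrite /density /avg -mulrBl -sumrB; congr (_ / _); apply: eq_bigr => i _.
  by have := le_chosen _ _ ab i; do 2 case: chosen; rewrite ?subrr ?subr0 // => /(_ isT).
rewrite distrC ger0_norm ?subr_ge0 //.
have [m mE /andP[m1 _]] := chosenE a0; have [m' mE' /andP[_ m2]] := chosenE b0.
rewrite (densityE mE) (densityE mE') -mulrBl ler_pdivrMr // mulrDl mulVf ?gt_eqF //.
have : (minn m' N.+1)%:R <= (minn m N.+1)%:R + (m' - m)%N%:R :> R.
  by rewrite -natrD ler_nat; lia.
have [mm|/ltnW mm] := leqP m m'.
  by rewrite natrB // !(mulrBr, mulrBl) ![_ * N.+1%:R]mulrC; lra.
rewrite (eqP mm) addr0 => h.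
have : 0 <= k * (b - a) * N.+1%:R.
  by rewrite !mulr_ge0 ?subr_ge0 // ltW.
by move: h; lra.
Qed.

(* The Horvitz-Thompson estimator of [a]: unbiased, and supported on the
   sampled thresholds (at [a = 0] it is identically [0]). *)
Definition estimate (a : R) (i : 'I_N.+1) : R :=
  if chosen a i then a / density a else 0.

Lemma estimate_ge0 a i : 0 <= a -> 0 <= estimate a i.
Proof.
move=> a0; rewrite /estimate; case: ifP => // _.
by rewrite divr_ge0 // avg_ge0.
Qed.

Lemma estimate_density a : 0 <= a -> density a * (a / density a) = a.
Proof.
rewrite le_eqVlt => /predU1P[<-|a0]; first by rewrite mul0r mulr0.
by rewrite mulrC divfK // gt_eqF // density_gt0.
Qed.

Lemma avg_estimate (phi : R -> R) a :
  avg (fun i => phi (estimate a i)) =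
  phi 0 + density a * (phi (a / density a) - phi 0).
Proof.
have -> : (fun i => phi (estimate a i)) =
    fun i => phi 0 + (chosen a i)%:R * (phi (a / density a) - phi 0).
  apply/funext => i; rewrite /estimate; case: chosen.
    by rewrite mul1r addrC subrK.
  by rewrite mul0r addr0.
by rewrite /avg big_split mulrDl -/(avg (fun=> phi 0)) avg_cst -mulr_suml mulrAC.
Qed.

Lemma mean_estimate a u : 0 <= a -> mean (fun w => estimate a (w u)) = a.
Proof.
move=> a0; rewrite mean_coord (avg_estimate id) subr0 add0r.
exact: estimate_density.
Qed.

(** Either sampling is certain and the estimate is deterministic, or its jump is at most [k^-1], as
    the Chernoff argument needs. *)
Lemma estimate_cases a : 0 <= a ->
  density a = 1 \/ 0 <= a / density a <= k^-1.
Proof.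
move=> a0; have [ka|ka] := leP 1 (k * a).
  left; apply/eqP; rewrite eq_le density_le1 /=.
  by apply: le_trans (density_ge a0); rewrite le_min lexx ka.
right; rewrite divr_ge0 ?avg_ge0 //=.
move: a0; rewrite le_eqVlt => /predU1P[<-|a0].
  by rewrite mul0r invr_ge0 ltW.
rewrite ler_pdivrMr ?density_gt0 // -(ler_pM2l k_gt0) mulVKf ?gt_eqF //.
apply: le_trans (density_ge (ltW a0)); rewrite le_min lexx andbT ltW //.
Qed.

Variable s : R.
Hypothesis s_ge0 : 0 <= s.
Hypothesis sk : s <= k / 2.

(** Bounds the logarithmic moment generating function per unit of [a]; [s <= k / 2] keeps small
    jumps within the range of [expR_le1D2]. *)
Let rate : R := s + 2 * s ^+ 2 / k.

Lemma rate_ge : s <= rate.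
Proof. by rewrite /rate lerDl divr_ge0 ?mulr_ge0 ?sqr_ge0 // ltW. Qed.

Lemma avg_exp_estimate a : 0 <= a ->
  avg (fun i => expR (s * estimate a i)) <= expR (a * rate).
Proof.
move=> a0; rewrite (avg_estimate (fun y => expR (s * y))) mulr0 expR0.
have [->|/andP[c0 ck]] := estimate_cases a0.
  rewrite divr1 mul1r addrC subrK ler_expR mulrC; apply: ler_wpM2l => //.
  exact: rate_ge.
apply: le_trans (expR_ge1Dx _); rewrite lerD2l.
set c := a / density a in c0 ck *.
have ac : density a * c = a by exact: estimate_density.
have e1 : expR (s * c) <= 1 + s * c + 2 * (s * c) ^+ 2.
  apply: expR_le1D2; rewrite mulr_ge0 //=.
  apply: le_trans (ler_pM s_ge0 c0 sk ck) _.
  by rewrite mulrAC mulfV ?gt_eqF // mul1r.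
apply: (@le_trans _ _ (density a * (s * c + 2 * (s * c) ^+ 2))).
  by apply: ler_wpM2l; [exact: avg_ge0|lra].
have -> : density a * (s * c + 2 * (s * c) ^+ 2) =
    (density a * c) * (s + 2 * s ^+ 2 * c) by ring.
rewrite ac; apply: ler_wpM2l => //; rewrite lerD2l; apply: ler_wpM2l => //.
by rewrite mulr_ge0 // sqr_ge0.
Qed.

(** The weight restricts to sampled thresholds. There the exponent is at most [s / k], or equals
    [s * a <= a * rate] if sampling is certain; the sum covers both cases. *)
Lemma avg_estimate_exp a : 0 <= a ->
  avg (fun i => estimate a i * expR (s * estimate a i)) <=
  a * expR (s / k + a * rate).
Proof.
move=> a0; rewrite (avg_estimate (fun y => y * expR (s * y))) mul0r add0r subr0.
rewrite mulrA estimate_density //; apply: ler_wpM2l => //; rewrite ler_expR.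
have ar : s * a <= a * rate by rewrite mulrC; apply: ler_wpM2l => //; exact: rate_ge.
have sk0 : 0 <= s / k by rewrite divr_ge0 // ltW.
have [->|/andP[c0 ck]] := estimate_cases a0; first by rewrite divr1; lra.
have : s * (a / density a) <= s / k by exact: ler_wpM2l.
have : 0 <= a * rate by apply: le_trans ar; rewrite mulr_ge0.
by lra.
Qed.

(* Exponential Markov inequality, with the factor [estimate (x e)] carried along:
   this bounds the failure probability conditionally on [e] being sampled. *)
Lemma mean_overload (x : U -> R) (D : {set U}) (e : U) (eta : R) :
  (forall u, 0 <= x u) -> \sum_(u in D) x u <= 1 -> e \in D ->
  mean (fun w => estimate (x e) (w e) *
     (1 + eta < \sum_(u in D) estimate (x u) (w u))%R%:R) <=
  x e * expR (s / k + 2 * s ^+ 2 / k - s * eta).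
Proof.
move=> x0 x1 eD.
(* [g] splits the weighted exponential into one factor per threshold, so that [mean_prod]
   applies. *)
pose g u (i : 'I_N.+1) : R := (if u == e then estimate (x e) i else 1) *
  (if u \in D then expR (s * estimate (x u) i) else 1).
have gE (w : W) : \prod_u g u (w u) = estimate (x e) (w e) *
    expR (s * \sum_(u in D) estimate (x u) (w u)).
  rewrite big_split /= -big_mkcond big_pred1_eq; congr (_ * _).
  by rewrite -big_mkcond /= mulr_sumr expR_sum.
apply: (@le_trans _ _ (mean (fun w => expR (- (s * (1 + eta))) * \prod_u g u (w u)))).
  apply: mean_le => w; rewrite gE mulrCA -expRD.
  apply: ler_wpM2l; first exact: estimate_ge0.
  case: ltP => [lt|_]; last exact: expR_ge0.
  rewrite -[leLHS]expR0 ler_expR addrC -mulrBr mulr_ge0 // subr_ge0; exact: ltW.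
rewrite meanZ mean_prod (bigD1 e) //=.
have ge : avg (g e) <= x e * expR (s / k + x e * rate).
  rewrite (_ : g e = fun i => estimate (x e) i * expR (s * estimate (x e) i)).
    exact: avg_estimate_exp.
  by apply/funext => i; rewrite /g eqxx eD.
have gother : \prod_(u | u != e) avg (g u) <= expR (\sum_(u in D | u != e) x u * rate).
  rewrite expR_sum big_mkcondl /=; apply: ler_prod => u ue.
  rewrite /g (negbTE ue); case: ifP => uD.
    apply/andP; split.
      by apply: avg_ge0 => i; rewrite mul1r expR_ge0.
    apply: le_trans (avg_exp_estimate (x0 u)).
    by apply: avg_le => i; rewrite mul1r.
  by rewrite mulr1 avg_cst ler01 lexx.
have g0 u : 0 <= avg (g u).
  apply: avg_ge0 => i; apply: mulr_ge0; first by case: ifP => _; rewrite ?estimate_ge0.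
  by case: ifP => _; rewrite ?expR_ge0.
apply: le_trans (ler_wpM2l (expR_ge0 _) (ler_pM (g0 e) (prodr_ge0 _ _) ge gother)) _.
  by move=> u _; exact: g0.
rewrite -[x e * _ * _]mulrA [leLHS]mulrCA.
apply: ler_wpM2l => //.
rewrite -!expRD ler_expR.
have : \sum_(u in D) x u * rate <= rate.
  rewrite -mulr_suml -[leRHS]mul1r; apply: ler_wpM2r => //.
  exact: le_trans rate_ge.
rewrite (bigD1 e) //= /rate; lra.
Qed.

End UniformThresholds.

(** * A uniform probability measure on finitely many naturals *)

Section UniformNat.
Variables (R : realType) (K : nat).

Let weight : {nonneg R} := NngNum (divr_ge0 ler01 (ler0n R K.+1)).

(** On [nat] every event is measurable, and expectations under finitely many Dirac masses are finite
    sums. *)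
Definition uniform_nat : set nat -> \bar R :=
  mscale weight (msum (fun i : nat => \d_i : {measure set nat -> \bar R}) K.+1).

HB.instance Definition _ := Measure.on uniform_nat.

Lemma uniform_nat_setT : uniform_nat [set: nat]%classic = 1%E.
Proof.
rewrite /uniform_nat /mscale /= /msum /=.
under eq_bigr do rewrite diracT.
by rewrite sumEFin -EFinM sumr_const card_ord mul1r mulVf // pnatr_eq0.
Qed.

HB.instance Definition _ := Measure_isProbability.Build _ _ _ uniform_nat uniform_nat_setT.

Lemma expectation_uniform_nat (f : nat -> R) : (forall i, 0 <= f i) ->
  ('E_uniform_nat[f] = ((\sum_(i < K.+1) f i) / K.+1%:R)%:E)%E.
Proof.
move=> f0; rewrite unlock ge0_integral_mscale //=; last first.
  by move=> i _; rewrite lee_fin.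
rewrite ge0_integral_measure_sum //=; last by move=> i _; rewrite lee_fin.
under eq_bigr do rewrite integral_dirac // diracT mul1e.
by rewrite sumEFin -EFinM mul1r mulrC.
Qed.

End UniformNat.

Lemma expectation_seed (R : realType) (B : finType) (b0 : B) (f : B -> R) :
  (forall b, 0 <= f b) ->
  ('E_(uniform_nat R #|B|.-1)[fun i => f (nth b0 (enum B) i)] =
    ((\sum_b f b) / #|B|%:R)%:E)%E.
Proof.
move=> f0; rewrite expectation_uniform_nat // prednK; last by apply/card_gt0P; exists b0.
by rewrite -[in RHS]big_enum /= (big_nth b0) big_mkord -cardE.
Qed.

Lemma card_symdiff (T : finType) (A B : {set T}) :
  #|symdiff A B| = (\sum_e ((e \in A) != (e \in B)))%N.
Proof.
rewrite -sum1_card big_mkcond; apply: eq_bigr => e _; rewrite !inE.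
by case: (e \in A); case: (e \in B).
Qed.

(** The extra one comes from [option V], the codomain of the end map. *)
Lemma matching_card (V : finType) (H M : {set pedge V}) :
  bipartite H -> matchingb H M -> (#|M| <= #|V|.+1)%N.
Proof.
move=> [A HA]; rewrite (matchingbE HA) => /lr_matchingP[_ injl _].
by rewrite -(card_in_imset injl) -card_option max_card.
Qed.

(** * The rounding scheme, its value and its recourse *)

Section Rounding.
Variables (R : realType) (V : finType) (N : nat) (eps : R).
Hypotheses (eps_gt0 : 0 < eps) (eps_lt1 : eps < 1).
Local Notation W := {ffun pedge V -> 'I_N.+1}.

(** At [s = boost * eps / 4] the exponent in [mean_overload] becomes [eps / 4 - 1 - ln (2 / eps)],
    whence a failure bound [eps / 2]. *)
Definition boost : R := 8 / eps ^+ 2 * (1 + ln (2 / eps)).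

Lemma log_ge0 : 0 <= ln (2 / eps).
Proof.
have [e0 el] := (eps_gt0, eps_lt1).
by apply: ln_ge0; rewrite ler_pdivlMr //; lra.
Qed.

Lemma boost_gt0 : 0 < boost.
Proof.
have [e0 el l0] := And3 eps_gt0 eps_lt1 log_ge0; rewrite mulr_gt0 ?divr_gt0 ?exprn_gt0 //; lra.
Qed.

Definition sampled (x : evec V R) (w : W) : {set pedge V} :=
  [set e | chosen boost (x e) (w e)].

Definition overloaded (x : evec V R) (w : W) (v : V) : bool :=
  1 + eps < \sum_(u in incident v) estimate boost (x u) (w u).

(** Dropping the edges at overloaded vertices and dividing by the permitted load makes the estimates
    feasible. *)
Definition scaled (x : evec V R) (w : W) : evec V R :=
  [ffun e : pedge V => if [exists v in val e, overloaded x w v] then 0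
             else estimate boost (x e) (w e) / (1 + eps)].

Lemma scaled_fractional (x : evec V R) (w : W) : (forall e : pedge V, 0 <= x e) ->
  fractional_matching (sampled x w) (scaled x w).
Proof.
move=> x0.
have est0 (e : pedge V) : 0 <= estimate boost (x e) (w e) by apply: estimate_ge0.
have [e0 el] := (eps_gt0, eps_lt1); have e1 : 0 < 1 + eps by lra.
split=> [e|v|e].
- by rewrite ffunE; case: ifP => // _; rewrite divr_ge0 // ltW.
- have [bad|] := boolP (overloaded x w v).
    rewrite big1 ?ler01 // => e; rewrite inE ffunE => ve.
    by rewrite ifT //; apply/exists_inP; exists v.
  rewrite /overloaded -leNgt => good.
  apply: (@le_trans _ _ (\sum_(u in incident v) estimate boost (x u) (w u) / (1 + eps))).
    by apply: ler_sum => e _; rewrite ffunE; case: ifP => // _; rewrite divr_ge0 // ltW.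
  by rewrite -mulr_suml ler_pdivrMr // mul1r.
- rewrite inE ffunE /estimate => /negbTE ->.
  by rewrite mul0r if_same.
Qed.

Lemma mean_overloaded (x : evec V R) (e : pedge V) (v : V) : (forall e : pedge V, 0 <= x e) ->
  (forall v, \sum_(u in incident v) x u <= 1) -> v \in val e ->
  mean (fun w : W => estimate boost (x e) (w e) * (overloaded x w v)%:R) <=
  x e * (eps / 2).
Proof.
move=> x0 x1 ve; have b0 := boost_gt0.
(* This [s] nearly minimizes [s / boost + 2 * s ^+ 2 / boost - s * eps]. *)
have s0 : 0 <= boost * eps / 4 by apply: divr_ge0 => //; apply: mulr_ge0; exact: ltW.
have sb : boost * eps / 4 <= boost / 2.
  have : boost * eps <= boost * 1 by rewrite ler_pM2l // ltW.
  by move: b0; lra.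
have ei : e \in incident v by rewrite inE.
have h := @mean_overload R (pedge V) N boost b0 _ s0 sb x (incident v) e eps x0 (x1 v) ei.
apply: le_trans h _.
apply: ler_wpM2l => //.
have -> : eps / 2 = expR (- ln (2 / eps)).
  by rewrite expRN lnK ?invf_div // posrE divr_gt0.
rewrite ler_expR.
have E1 : boost * eps / 4 / boost = eps / 4 by field; rewrite gt_eqF.
have E2 : 2 * (boost * eps / 4) ^+ 2 / boost = boost * eps ^+ 2 / 8.
  by field; rewrite gt_eqF.
have E3 : boost * eps ^+ 2 = 8 * (1 + ln (2 / eps)).
  by rewrite /boost; field; rewrite gt_eqF.
have E4 : boost * eps / 4 * eps = boost * eps ^+ 2 / 4 by field.
have [e0 el l0] := And3 eps_gt0 eps_lt1 log_ge0; rewrite E1 E2 E4 E3; lra.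
Qed.

(** A union bound over the two ends of [e], each losing a fraction [eps / 2]. *)
Lemma mean_scaled (x : evec V R) (e : pedge V) : (forall e : pedge V, 0 <= x e) ->
  (forall v, \sum_(u in incident v) x u <= 1) ->
  (1 - eps) / (1 + eps) * x e <= mean (fun w : W => scaled x w e).
Proof.
move=> x0 x1; have [e0 el] := (eps_gt0, eps_lt1); have e1 : 0 < 1 + eps by lra.
have b0 := boost_gt0.
pose est (w : W) := estimate boost (x e) (w e).
have est0 w : 0 <= est w by exact: estimate_ge0.
apply: (@le_trans _ _ (mean (fun w : W => (1 + eps)^-1 *
    (est w - \sum_(v in val e) est w * (overloaded x w v)%:R)))).
  rewrite meanZ meanB mean_estimate // mean_sum mulrAC mulrC ler_pM2l ?invr_gt0 //.
  rewrite mulrBl mul1r lerD2l lerN2.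
  apply: le_trans (ler_sum _ (fun v (ve : v \in val e) => mean_overloaded x0 x1 ve)) _.
  by rewrite sumr_const (eqP (valP e)) -mulr_natr; lra.
apply: mean_le => w; rewrite ffunE; case: ifP => [/exists_inP[v ve bad]|_].
  rewrite pmulr_rle0 ?invr_gt0 // subr_le0 (bigD1 v) //= bad mulr1 lerDl.
  by apply: sumr_ge0 => u _; rewrite mulr_ge0.
rewrite mulrC ler_pM2r ?invr_gt0 // gerBl.
by apply: sumr_ge0 => u _; rewrite mulr_ge0.
Qed.

Lemma mean_sampled_change (x y : evec V R) :
  (forall e : pedge V, 0 <= x e) -> (forall e : pedge V, 0 <= y e) ->
  mean (fun w : W => #|symdiff (sampled x w) (sampled y w)|%:R) <=
  boost * l1norm (x - y) + #|pedge V|%:R / N.+1%:R.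
Proof.
move=> x0 y0.
have -> : (fun w : W => #|symdiff (sampled x w) (sampled y w)|%:R : R) =
    fun w => \sum_e (chosen boost (x e) (w e) != chosen boost (y e) (w e))%:R.
  apply/funext => w; rewrite card_symdiff natr_sum; apply: eq_bigr => e _.
  by rewrite !inE.
rewrite mean_sum /l1norm mulr_sumr mulr_natl -sumr_const -big_split /=.
apply: ler_sum => e _; rewrite !ffunE.
exact: (mean_chosen_change _ boost_gt0 _ (x0 e) (y0 e)).
Qed.

(** The first entry exceeds the size of every bipartite matching, so the loss [m %/ cutoff]
    vanishes; the second exceeds [eps^-1], so the loss is at most [eps * m]. *)
Definition cutoff : nat := minn #|V|.+2 (Num.trunc eps^-1).+1.

(** The step bound is [cutoff.-1] since [repair_value] divides by its successor. *)
Definition follow (w : W) (M : {set pedge V}) (x : evec V R) : {set pedge V} :=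
  repair cutoff.-1 (sampled x w) (M :&: sampled x w).

Definition rounded (h : seq (evec V R)) (w : W) : {set pedge V} :=
  foldl (follow w) set0 h.

Lemma rounded_historyS (x : nat -> evec V R) t w :
  rounded (history x t.+1) w = follow w (rounded (history x t) w) (x t.+1).
Proof.
by rewrite /rounded /history -[t.+1]addn1 iotaD map_cat foldl_cat /= add1n addn1.
Qed.

Lemma rounded_matching (x : nat -> evec V R) t w : x 0 = 0 ->
  matchingb (sampled (x t) w) (rounded (history x t) w).
Proof.
move=> x0; elim: t => [|t IH]; first exact: matchingb0.
by rewrite rounded_historyS; apply/repair_matching/(matchingbI _ IH).
Qed.

Lemma cutoff_gt0 : (0 < cutoff)%N.
Proof. by rewrite /cutoff leq_min. Qed.

Lemma cutoff_div m : (m <= #|V|.+1)%N -> (m %/ cutoff)%:R <= eps * m%:R.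
Proof.
move=> mV; rewrite /cutoff; have [_|_] := leqP #|V|.+2 (Num.trunc eps^-1).+1.
  by rewrite divn_small // mulr_ge0 // ltW.
have i0 : 0 <= eps^-1 by rewrite invr_ge0 ltW.
have /andP[_ it] := truncn_itv i0.
rewrite mulrC -ler_pdivrMr //.
apply: le_trans (ler_wpM2l (ler0n _ _) (ltW it)) _.
by rewrite -natrM ler_nat leq_divM.
Qed.

Lemma mean_rounded (x : nat -> evec V R) (E : {set pedge V}) t :
  x 0 = 0 -> (0 < t)%N -> bipartite E -> fractional_matching E (x t) ->
  (1 - 4 * eps) * value E (x t) <=
  mean (fun w : W => #|rounded (history x t) w|%:R).
Proof.
move=> x00 t0 [A EA] [x0 x1 xE].
have b0 := boost_gt0.
have sE w : sampled (x t) w \subset E.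
  apply/subsetP => e; rewrite inE; apply: contraTT => /xE ->.
  by rewrite chosen0.
have bip w : bipartite (sampled (x t) w).
  by exists A => e /(subsetP (sE w)); exact: EA.
have size_ge w : \sum_e scaled (x t) w e <= (1 + eps) * #|rounded (history x t) w|%:R.
  have fm := scaled_fractional w x0; have [_ _ out] := fm.
  case: t t0 x0 x1 xE sE bip fm out => // t _ x0 x1 xE sE bip fm out.
  have mM := rounded_matching t w x00.
  have mI := matchingbI (sampled (x t.+1) w) mM.
  rewrite (bigID (mem (sampled (x t.+1) w))) /= [X in _ + X]big1 ?addr0; last first.
    by move=> e; exact: out.
  apply: le_trans (repair_value cutoff.-1 (bip w) mI fm) _.
  rewrite rounded_historyS /follow; set M := repair _ _ _.
  rewrite prednK ?cutoff_gt0 // natrD mulrDl mul1r lerD2l; apply: cutoff_div.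
  by apply: matching_card (bip w) _; exact: repair_matching.
have: mean (fun w : W => \sum_e scaled (x t) w e) <=
    (1 + eps) * mean (fun w : W => #|rounded (history x t) w|%:R).
  by rewrite -meanZ; apply: mean_le.
rewrite mean_sum.
have vE : value E (x t) = \sum_e x t e.
  rewrite /value [RHS](bigID (mem E)) /= [X in _ = _ + X]big1 ?addr0 //.
have : (1 - eps) / (1 + eps) * value E (x t) <= \sum_e mean (fun w : W => scaled (x t) w e).
  by rewrite vE mulr_sumr; apply: ler_sum => e _; exact: mean_scaled.
move=> /le_trans h /h {h}; have [e0 el] := (eps_gt0, eps_lt1); have e1 : 0 < 1 + eps by lra.
rewrite -ler_pdivrMl //; apply: le_trans.
rewrite mulrA; apply: ler_wpM2r; first by apply: sumr_ge0.
rewrite [leRHS]mulrC -mulrA -invfM ler_pdivlMr ?mulr_gt0 //.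
(* One [1 + eps] and the [1 - eps] come from scaling and overloads, the other [1 + eps] from
   stopping at short augmentations. *)
have -> : (1 - 4 * eps) * ((1 + eps) * (1 + eps)) =
  1 - eps - (eps + 7 * eps ^+ 2 + 4 * eps ^+ 3) by ring.
rewrite gerBl !addr_ge0 ?mulr_ge0 ?exprn_ge0 //; exact: ltW.
Qed.

Lemma mean_recourse (x : nat -> evec V R) T :
  x 0 = 0 -> (forall t, (t <= T)%N -> forall e : pedge V, 0 <= x t e) ->
  mean (fun w : W => \sum_(1 <= t < T.+1)
     #|symdiff (rounded (history x t) w) (rounded (history x t.-1) w)|%:R) <=
  2 * cutoff%:R * (boost * \sum_(1 <= t < T.+1) l1norm (x t - x t.-1)
     + T%:R * (#|pedge V|%:R / N.+1%:R)).
Proof.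
move=> x00 x0.
apply: (@le_trans _ _ (mean (fun w : W => 2 * cutoff%:R * \sum_(1 <= t < T.+1)
     #|symdiff (sampled (x t) w) (sampled (x t.-1) w)|%:R))).
  apply: mean_le => w; rewrite -!natr_sum -!natrM ler_nat mul2n -(prednK cutoff_gt0).
  apply: (@total_recourse _ _ (fun t => sampled (x t) w) (fun t => rounded (history x t) w)).
  - by apply/setP => e; rewrite !inE x00 ffunE chosen0.
  - by [].
  - by move=> t; exact: rounded_historyS.
rewrite meanZ ler_wpM2l ?mulr_ge0 // mean_sum.
rewrite mulr_sumr mulr_natl -[X in _ *+ X](subn1 T.+1) -sumr_const_nat -big_split /=.
apply: ler_sum_nat => t /andP[t1 tT]; apply: mean_sampled_change; apply: x0; lia.
Qed.

End Rounding.

(** * Constants and assembly of the scheme *)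

Lemma ln_nat_ge_half (R : realType) (n : nat) : (2 <= n)%N -> 2^-1 <= ln n%:R :> R.
Proof.
move=> n2; have h : ln (1 - 2^-1) <= - 2^-1 :> R by apply: le_ln1Dx; lra.
have : ln (2^-1 : R) = - ln 2 by rewrite lnV // posrE.
rewrite (_ : 2^-1 = 1 - 2^-1 :> R); last by lra.
move=> h2; apply: (@le_trans _ _ (ln 2)); first by move: h; rewrite h2; lra.
by rewrite ler_ln ?posrE ?ltr0n ?ler_nat //; lia.
Qed.

(** In [ln (8 / delta) <= ln n + 8 / (n * delta)] the first term is multiplied by the cutoff bound
    [8 / delta], the second by [2 * n]. So no [ln (1 / delta)] survives, however small [delta]
    is. *)
Lemma cutoff_boost_le (R : realType) (V : finType) (delta : R) :
  (2 <= #|V|)%N -> 0 < delta < 1 ->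
  2 * (cutoff V (delta / 4))%:R * boost (delta / 4) <=
  256 * 56 * (ln #|V|%:R / delta ^+ 3).
Proof.
set n := #|V| => n2 /andP[d0 d1].
have n0 : 0 < n%:R :> R by rewrite ltr0n; lia.
have l2 : 2^-1 <= ln n%:R :> R by exact: ln_nat_ge_half.
set c : R := (cutoff V (delta / 4))%:R; set L : R := ln n%:R in l2 *.
have c0 : 0 <= c by exact: ler0n.
have cn : c <= 2 * n%:R.
  by rewrite -natrM ler_nat; apply: leq_trans (geq_minl _ _) _; rewrite -/n; lia.
have cd : c <= 8 / delta.
  apply: (@le_trans _ _ (Num.trunc (delta / 4)^-1).+1%:R).
    by rewrite ler_nat geq_minr.
  have i0 : 0 <= (delta / 4)^-1 by rewrite invr_ge0 divr_ge0 // ltW.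
  have /andP[+ _] := truncn_itv i0; rewrite invf_div -natr1 => h.
  have : 1 <= 4 / delta by rewrite ler_pdivlMr //; lra.
  by move: h; rewrite !(mulrC _ delta^-1); lra.
have lnd : ln (8 / delta) <= L + 8 / (n%:R * delta).
  have -> : 8 / delta = n%:R * (8 / (n%:R * delta)) by field; rewrite !gt_eqF.
  have p0 : 0 < 8 / (n%:R * delta) by rewrite divr_gt0 ?mulr_gt0.
  by rewrite lnM ?posrE // lerD2l ltW // ln_sublinear.
have key : c * (1 + ln (8 / delta)) <= 56 * (L / delta).
  apply: (@le_trans _ _ (c * (1 + L) + c * (8 / (n%:R * delta)))).
    by rewrite -mulrDr; apply: ler_wpM2l => //; lra.
  have h1 : c * (1 + L) <= 8 / delta * (1 + L) by apply: ler_wpM2r cd; lra.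
  have h2 : c * (8 / (n%:R * delta)) <= 2 * n%:R * (8 / (n%:R * delta)).
    by apply: ler_wpM2r cn; rewrite divr_ge0 // mulr_ge0 // ltW.
  have h3 : 2 * n%:R * (8 / (n%:R * delta)) = 16 / delta by field; rewrite !gt_eqF.
  (* [56 = 8 + 48]: as [L >= 1/2], the constants [8 + 16] are at most [48 * L]. *)
  have h4 : 0 <= delta^-1 * (48 * L - 24) by apply: mulr_ge0; [rewrite invr_ge0 ltW|lra].
  have h5 : delta^-1 * (48 * L - 24) = 56 * (L / delta) - (8 / delta * (1 + L) + 16 / delta).
    by field; rewrite gt_eqF.
  by move: h1 h2 h4; rewrite h3 h5; lra.
have -> : 2 * c * boost (delta / 4) = 256 / delta ^+ 2 * (c * (1 + ln (8 / delta))).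
  rewrite /boost (_ : 2 / (delta / 4) = 8 / delta); last by field; rewrite gt_eqF.
  by field; rewrite gt_eqF.
have regroup (a b : R) :
    a / delta ^+ 2 * (b * (L / delta)) = a * b * (L / delta ^+ 3).
  by field; rewrite gt_eqF.
rewrite -regroup; apply: ler_wpM2l key.
by apply: divr_ge0; [exact: ler0n|rewrite exprn_ge0 // ltW].
Qed.

Lemma card_pedge_small (V : finType) : (#|V| < 2)%N -> #|pedge V| = 0%N.
Proof.
move=> V2; apply: eq_card0 => e.
by have := leq_trans (max_card (mem (val e))) (V2 : (#|V| <= 1)%N); rewrite (eqP (valP e)).
Qed.

Theorem theorem4p3 (R : realType) :
  exists C1 C2 : R, 0 < C1 /\ 0 < C2 /\
  forall (V : finType) (n : nat), #|V| = n ->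
  forall beta delta alpha : R,
    0 < beta <= 1 -> 0 < delta < 1 -> 1 <= alpha ->
  exists (d : measure_display) (Omega : measurableType d)
         (P : probability Omega R) (A : dynamic_scheme V R Omega),
  forall (T : nat) (E : nat -> {set pedge V}) (x : nat -> evec V R),
    dynamic_bipartite_graph T E ->
    x 0%N = 0 ->
    (forall t, (1 <= t <= T)%N -> in_K beta (E t) (x t)) ->
  [/\ forall t w, (1 <= t <= T)%N -> matching_in (E t) (maintained A x t w),
      ('E_P[recourse A x T] <=
        (C1 * (alpha * ln n%:R / delta ^+ 3)
            * \sum_(1 <= t < T.+1) l1norm (x t - x t.-1)
         + C2 * (T%:R / (delta * n%:R `^ alpha)))%:E)%E
    & forall t, (1 <= t <= T)%N ->
        (((1 - delta) * value (E t) (x t))%:E <=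
          'E_P[fun w => #|maintained A x t w|%:R])%E].
Proof.
exists (256 * 56), 1; split; first by apply: mulr_gt0; rewrite ltr0n.
split=> // V n Vn beta delta alpha _ d01 a1.
have /andP[d0 d1] := d01.
(* [mean_rounded] loses [4 * eps]. *)
pose eps : R := delta / 4.
have e0 : 0 < eps by rewrite divr_gt0.
have e1 : eps < 1 by rewrite /eps; lra.
pose c : R := (cutoff V eps)%:R.
(* [N] will satisfy [load < N.+1], so that for [n > 0] the grid error per step,
   [2 * c * #|pedge V| / N.+1], is at most the inverse of [delta * n ^ alpha], whatever [T] is. *)
pose load : R := 2 * c * #|pedge V|%:R * (delta * n%:R `^ alpha).
have load0 : 0 <= load by rewrite !mulr_ge0 ?powR_ge0 // ltW.
pose N := Num.trunc load.
pose seed0 : {ffun pedge V -> 'I_N.+1} := [ffun=> ord0].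
pose seed (i : nat) := nth seed0 (enum {ffun pedge V -> 'I_N.+1}) i.
have meas (h : seq (evec V R)) (M : {set pedge V}) :
    measurable [set i : nat | rounded eps h (seed i) = M]%classic by [].
exists _, nat, (uniform_nat R #|{ffun pedge V -> 'I_N.+1}|.-1).
exists (@DynamicScheme V R _ nat (fun h i => rounded eps h (seed i)) meas (fun=> erefl)).
move=> T E x [bipE _] x00 xK.
have fm t : (1 <= t <= T)%N -> fractional_matching (E t) (x t) by move=> /xK[].
have x0 t : (t <= T)%N -> forall e : pedge V, 0 <= x t e.
  by case: t => [|t] tT e; [rewrite x00 ffunE|case: (fm t.+1 tT)].
have expect (f : {ffun pedge V -> 'I_N.+1} -> R) : (forall w, 0 <= f w) ->
    ('E_(uniform_nat R #|{ffun pedge V -> 'I_N.+1}|.-1)[fun i => f (seed i)] = (mean f)%:E)%E.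
  exact: expectation_seed.
split.
- move=> t i tT; rewrite /maintained /=.
  have /matchingbP[sub dis] := rounded_matching eps t (seed i) x00.
  split=> //; apply: subset_trans sub _; apply/subsetP => e; rewrite inE.
  by apply: contraTT; have [_ _ xE] := fm t tT => /xE ->; rewrite chosen0.
- rewrite (expect (fun w => \sum_(1 <= t < T.+1)
      #|symdiff (rounded eps (history x t) w) (rounded eps (history x t.-1) w)|%:R)).
    rewrite lee_fin; apply: le_trans (mean_recourse N e0 e1 x00 x0) _.
    set S := \sum_(1 <= t < T.+1) l1norm _.
    have S0 : 0 <= S by apply: sumr_ge0 => t _; apply: sumr_ge0.
    have T0 : 0 <= T%:R / (delta * n%:R `^ alpha).
      by rewrite divr_ge0 // mulr_ge0 ?powR_ge0 // ltW.
    (* With fewer than two vertices there is no potential edge and both sums vanish; the logarithmic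
       estimate is for [n >= 2]. *)
    have [V2|V2] := ltnP #|V| 2.
      have V0 := card_pedge_small V2.
      have -> : S = 0.
        apply: big1 => t _; apply: big1 => e _.
        by have := card0_eq V0 e; rewrite inE.
      by rewrite V0 mul0r !mulr0 addr0 mulr0 add0r mul1r.
    rewrite mulrDr mul1r; apply: lerD.
      rewrite mulrA; apply: ler_wpM2r => //.
      apply: le_trans (cutoff_boost_le V2 d01) _.
      rewrite Vn; apply: ler_wpM2l; first by apply: mulr_ge0; exact: ler0n.
      apply: ler_wpM2r.
        by rewrite invr_ge0 exprn_ge0 // ltW.
      have h := @ln_nat_ge_half R n; rewrite -[leLHS]mul1r; apply: ler_wpM2r => //.
      by apply: le_trans (h _); rewrite -?Vn.
    have np : 0 < delta * n%:R `^ alpha.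
      by rewrite mulr_gt0 // powR_gt0 // ltr0n -Vn; lia.
    rewrite mulrCA; apply: ler_wpM2l => //.
    have /andP[_ /ltW loadN] := truncn_itv load0.
    rewrite -[leRHS]mul1r ler_pdivlMr // -/c.
    have -> : 2 * c * (#|pedge V|%:R / N.+1%:R) * (delta * n%:R `^ alpha) =
      load / N.+1%:R by rewrite /load; ring.
    by rewrite ler_pdivrMr ?ltr0n // mul1r.
  by move=> w; apply: sumr_ge0.
- move=> t tT; rewrite (expect (fun w => #|rounded eps (history x t) w|%:R)) //.
  rewrite lee_fin (_ : delta = 4 * eps); last by rewrite /eps; lra.
  have [t0 tT'] := andP tT.
  exact (mean_rounded N e0 e1 x00 t0 (bipE t tT') (fm t tT)).
Qed.
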